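(* For all $B\ge 0$, $\sigma>0$ and $c>0$, the asymptotic quantized minimax risk $$R(B,\sigma,c)=\liminf_{n\to\infty}\ \inf_{M_n\in\mathcal M_{n,B}}\ \sup_{\theta^n\in\Theta_n(c)}\ \mathbb E\, d(\theta^n,M_n(X^n)),\qquad X^n\sim\mathcal N(\theta^n,\sigma^2 I_n),$$ satisfies $$R(B,\sigma,c)\ \ge\ \frac{\sigma^2c^2}{\sigma^2+c^2}+\frac{c^4}{\sigma^2+c^2}\,2^{-2B}.$$
   Context: For $u,v\in\mathbb R^n$, $d(u,v)=\frac1n\sum_{i=1}^n(u_i-v_i)^2$. The parameter space is the ball $\Theta_n(c)=\{\theta^n=(\theta_1,\dots,\theta_n)\in\mathbb R^n:\frac1n\sum_{i=1}^n\theta_i^2\le c^2\}$. The observation is $X^n=(X_1,\dots,X_n)$ with $X_i\sim\mathcal N(\theta_i,\sigma^2)$ independent, where $\theta^n$ is deterministic and unknown and $\sigma^2$ is known; $\mathbb E$ is over $X^n$ for the given $\theta^n$. An $(n,B)$-rate estimation code is a pair $M_n=(\phi_n,\psi_n)$ of a (measurable) encoding function $\phi_n:\mathbb R^n\to\{1,2,\dots,2^{nB}\}$ and a decoding function $\psi_n:\{1,2,\dots,2^{nB}\}\to\mathbb R^n$; one writes $M_n(X^n)=\psi_n(\phi_n(X^n))$, so $M_n$ is a map $\mathbb R^n\to\mathbb R^n$ taking at most $2^{nB}$ values (if $2^{nB}$ is not an integer, the index set is $\{1,\dots,\lfloor 2^{nB}\rfloor\}$). $\mathcal M_{n,B}$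 is the set of all $(n,B)$-rate estimation codes. The code may depend on $n,B,\sigma,c$ but not on $\theta^n$. *)

(* Defs.v *)
From HB Require Import structures.
From mathcomp Require Import all_boot all_order all_algebra.
From mathcomp Require Import all_classical all_reals all_analysis.

Set Implicit Arguments.
Unset Strict Implicit.
Unset Printing Implicit Defensive.

Import Order.TTheory GRing.Theory Num.Theory.
Import numFieldNormedType.Exports.

Local Open Scope classical_set_scope.
Local Open Scope ring_scope.

(* Vectors of R^n are n-tuples, which the library equips with the product
   sigma-algebra. *)

Section normal_vector.
Context {R : realType}.

(* measurableTypeR R is R, with the display on which normal_prob is defined. *)
Definition tuple_cons n (p : measurableTypeR R * n.-tuple R) : n.+1.-tuple R :=
  [the n.+1.-tuple R of p.1 :: p.2].

Lemma measurable_tuple_cons n : measurable_fun [set: _] (@tuple_cons n).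
Proof. exact: measurable_cons. Qed.

HB.instance Definition _ n :=
  isMeasurableFun.Build _ _ _ _ (@tuple_cons n) (@measurable_tuple_cons n).

(* N(theta, sigma^2 I_n) as the product of the one-dimensional laws
   N(theta_i, sigma^2), by iterating the binary product measure; in the
   library, the second argument of normal_prob is the standard deviation. *)
Fixpoint normal_vec (sigma : R) (n : nat) :
    n.-tuple R -> probability (n.-tuple R) R :=
  match n with
  | 0 => fun theta => \d_theta
  | m.+1 => fun theta =>
      distribution
        (normal_prob (thead theta) sigma \x
         normal_vec sigma ([tuple of behead theta] : m.-tuple R))%E
        (@tuple_cons m)
  end.

Lemma normal_vec_box (sigma : R) n (theta : n.-tuple R) (A : 'I_n -> set R) :
  (forall i, measurable (A i)) ->
  normal_vec sigma theta [set x | forall i, A i (tnth x i)] =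
  (\prod_(i < n) normal_prob (tnth theta i) sigma (A i))%E.
Proof.
elim: n theta A => [|n IH] theta A mA /=.
  rewrite big_ord0 diracE mem_set//= => -[]//.
rewrite big_ord_recl /distribution /pushforward.
set B := (X in product_measure1 _ _ X).
have -> : B = A ord0 `*` [set x | forall i, A (lift ord0 i) (tnth x i)].
  apply/seteqP; split => -[x y]; rewrite /B /=.
    move=> H; split; first exact: (H ord0).
    by move=> i; move: (H (lift ord0 i)); rewrite /tuple_cons/= tnthS.
  move=> [Hx Hy] i; have [->//|] := eqVneq i ord0.
  by case: (unliftP ord0 i) => [j ->|->]; rewrite ?eqxx// /tuple_cons/= tnthS.
rewrite product_measure1E//.
  congr (_ * _)%E.
  apply: (etrans (IH [tuple of behead theta] (fun i => A (lift ord0 i)) _)).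
    by move=> i; exact: mA.
  by apply: eq_bigr => i _; rewrite [in RHS](tuple_eta theta) tnthS.
exact: (mA ord0).
rewrite (_ : [set x | _] = \bigcap_(i in [set: 'I_n])
    ((fun x : n.-tuple R => tnth x i) @^-1` A (lift ord0 i))); last first.
  by apply/seteqP; split => x H i; [move=> _|]; exact: (H i).
apply: fin_bigcap_measurable => // i _.
rewrite -[X in measurable X]setTI; exact: measurable_tnth.
Qed.

End normal_vector.

Section quantized_minimax_risk.
Context {R : realType}.

Definition distortion n (u v : n.-tuple R) : R :=
  n%:R^-1 * \sum_(i < n) (tnth u i - tnth v i) ^+ 2.

Definition Theta n (c : R) : set (n.-tuple R) :=
  [set theta | n%:R^-1 * \sum_(i < n) tnth theta i ^+ 2 <= c ^+ 2].

Definition codebook_size n (B : R) : nat := Num.truncn (2 `^ (n%:R * B)).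

(* The index set {1, ..., N} is represented by 'I_N. *)
Record rate_code n (B : R) := RateCode {
  encoder : n.-tuple R -> 'I_(codebook_size n B) ;
  decoder : 'I_(codebook_size n B) -> n.-tuple R ;
  measurable_encoder : forall k, measurable (encoder @^-1` [set k]) }.

Definition quantize n B (M : rate_code n B) (x : n.-tuple R) : n.-tuple R :=
  decoder M (encoder M x).

Definition risk n B (sigma : R) (M : rate_code n B) (theta : n.-tuple R) :
    \bar R :=
  'E_(normal_vec sigma theta)[fun x => distortion theta (quantize M x)].

Definition minimax_risk n (B sigma c : R) : \bar R :=
  ereal_inf [set ereal_sup [set risk sigma M theta | theta in Theta c]
            | M in [set: rate_code n B]].

Definition asymptotic_minimax_risk (B sigma c : R) : \bar R :=
  limn_einf (fun n => minimax_risk n B sigma c).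

End quantized_minimax_risk.

(* Main.v *)
Require Import Defs.
From HB Require Import structures.
From mathcomp Require Import all_boot all_order all_algebra.
From mathcomp Require Import all_classical all_reals all_analysis measurable_realfun.
From mathcomp Require Import ring lra.

Set Implicit Arguments.
Unset Strict Implicit.
Unset Printing Implicit Defensive.

Import Order.TTheory GRing.Theory Num.Theory.
Import numFieldNormedType.Exports.

Local Open Scope classical_set_scope.
Local Open Scope ring_scope.

(* Put the Gaussian prior N(0, tau^2) with tau = c / r, r > 1, on the coordinates of
   theta. Rotating the independent standard vectors (t, z) behind theta = tau t and
   X = theta + sigma z makes X = rho y, with rho^2 = sigma^2 + tau^2, and writes theta
   as tau^2 / rho y plus an independent Gaussian of variance
   tau^2 sigma^2 / rho^2; so the Bayes risk of a code is this variance plus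
   the distortion of a 2^(nB)-point quantization of a Gaussian vector, which is at
   least the variance times 2^(-2B) (Shannon's lower bound, in an
   elementary form based on u >= 1 + ln u). The prior charges the complement of the
   ball, but codewords of root mean square above 2 c may be replaced by 0 without
   increasing the loss on the ball, and then the contribution of the complement
   is at most K / (1 + n h) with h > 0, by comparison with the likelihood ratio of
   N(0, c^2) with respect to the prior. Let n tend to infinity, then r to 1. *)

(** * One-dimensional normal laws *)

Section one_dimensional.
Context {R : realType}.
Local Notation mu := (@lebesgue_measure R).
Local Notation RM := (measurableTypeR R).

Lemma measurable_affine (a b : R) :
  measurable_fun [set: RM] (fun x : RM => a * x + b : RM).
Proof. by apply: measurable_funD => //; exact: measurable_funM. Qed.

(** The left side is a measure in [A], so by uniqueness of Lebesgue measure it is enough to compare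
    both on half-open intervals. For [a < 0] the preimage is closed at the other end, with the same
    length. *)
Lemma lebesgue_measure_affine (a b : R) (A : set R) : a != 0 -> measurable A ->
  (`|a|%:E * mu ((fun x => (a * x + b)%R) @^-1` A) = mu A)%E.
Proof.
move=> a0 mA.
pose na := NngNum (normr_ge0 a).
have mg := measurable_affine a b.
pose g (x : RM) : RM := a * x + b.
pose nu : {measure set RM -> \bar R} :=
  mscale na (pushforward mu g).
suff : forall A, measurable A -> mu A = nu mg A by move=> /(_ A mA) ->.
apply: lebesgue_measure_unique => _ [[l u]] _ <-.
rewrite /nu/= /mscale/= /pushforward.
have [ap|an] : 0 < a \/ a < 0 by case/lt_total/orP : a0; [right|left].
- rewrite (_ : _ @^-1` _ = `](l - b) / a, (u - b) / a]%classic); last first.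
    apply/seteqP; split=> x/=; rewrite !in_itv/= ltr_pdivrMr// ler_pdivlMr//;
      by rewrite ltrBlDr lerBrDr (mulrC x).
  rewrite !lebesgue_measure_itv/= !lte_fin ltr_pM2r ?invr_gt0// ltrD2r.
  case: ifPn => _; last by rewrite mule0.
  by rewrite gtr0_norm// -!EFinD -EFinM; congr EFin; field; rewrite gt_eqF.
- rewrite (_ : _ @^-1` _ = `[(u - b) / a, (l - b) / a[%classic); last first.
    apply/seteqP; split=> x/=; rewrite !in_itv/= ltr_ndivlMr// ler_ndivrMr//;
      by rewrite ltrBlDr lerBrDr (mulrC x) andbC.
  rewrite !lebesgue_measure_itv/= !lte_fin ltr_nM2r ?invr_lt0// ltrD2r.
  case: ifPn => _; last by rewrite mule0.
  by rewrite ltr0_norm// -!EFinD -EFinM; congr EFin; field.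
Qed.

Lemma ge0_integral_affine (a b : R) (f : RM -> \bar R) : a != 0 ->
  measurable_fun [set: RM] f -> (forall x, 0 <= f x)%E ->
  (\int[mu]_x f x = `|a|%:E * \int[mu]_x f (a * x + b)%R)%E.
Proof.
move=> a0 mf f0.
pose na := NngNum (normr_ge0 a).
have mg := measurable_affine a b.
pose g (x : RM) : RM := a * x + b.
pose nu : {measure set RM -> \bar R} :=
  mscale na (pushforward mu g).
transitivity (\int[nu mg]_x f x)%E.
  by apply: eq_measure_integral => A mA _; exact/esym/(lebesgue_measure_affine b a0 mA).
by rewrite ge0_integral_mscale//= ge0_integral_pushforward.
Qed.

(** [normal_pdf] and the Radon-Nikodym derivative of the law have the same integral over every
    measurable set, hence agree almost everywhere. *)
Lemma ge0_integral_normal_prob (m s : R) (f : RM -> \bar R) :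
  measurable_fun [set: RM] f -> (forall x, 0 <= f x)%E ->
  (\int[normal_prob m s]_x f x = \int[mu]_x (f x * (normal_pdf m s x)%:E))%E.
Proof.
move=> mf f0; have dom := @normal_prob_dominates R m s.
rewrite -(Radon_Nikodym_SigmaFinite.change_of_variables dom)//.
have mh := measurable_int _ (Radon_Nikodym_SigmaFinite.f_integrable dom).
have mp : measurable_fun [set: RM] (fun x => (normal_pdf m s x)%:E).
  by apply/measurable_EFinP; exact: measurable_normal_pdf.
apply: ae_eq_integral => //; [exact: emeasurable_funM..|].
apply: ae_eqe_mul2l; apply: integral_ae_eq => //.
  exact: Radon_Nikodym_SigmaFinite.f_integrable.
by move=> E _ mE; rewrite -Radon_Nikodym_SigmaFinite.f_integral.
Qed.

Lemma ge0_integral_normal_prob_affine (m s : R) (f : RM -> \bar R) : s != 0 ->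
  measurable_fun [set: RM] f -> (forall x, 0 <= f x)%E ->
  (\int[normal_prob m s]_x f x = \int[normal_prob 0 1]_z f (m + s * z)%R)%E.
Proof.
move=> s0 mf f0.
have mf' : measurable_fun [set: RM] (fun z : RM => f (m + s * z)).
  by apply: measurableT_comp => //; apply: measurable_funD => //; exact: measurable_funM.
rewrite (ge0_integral_normal_prob m s mf f0).
rewrite (ge0_integral_normal_prob 0 1 mf' (fun=> f0 _)).
have mp (m' s' : R) : measurable_fun [set: RM] (fun x : RM => (normal_pdf m' s' x)%:E).
  by apply/measurable_EFinP; exact: measurable_normal_pdf.
rewrite (@ge0_integral_affine s m)//; last 2 first.
- exact: emeasurable_funM.
- by move=> x; rewrite mule_ge0// lee_fin normal_pdf_ge0.
rewrite -ge0_integralZl//; last 2 first.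
- apply: emeasurable_funM.
    by under eq_fun do rewrite addrC.
  exact: (measurableT_comp (mp m s) (measurable_affine s m)).
- by move=> x _; rewrite mule_ge0// lee_fin normal_pdf_ge0.
apply: eq_integral => z _; rewrite muleCA addrC; congr (_ * _)%E.
rewrite -EFinM !normal_pdfE ?oner_neq0// /normal_peak /normal_fun; congr EFin.
rewrite mulrA; congr (_ * _); last first.
  by congr expR; field.
rewrite -mulrnAr sqrtrM ?sqr_ge0// sqrtr_sqr expr1n mul1r invfM mulrA.
by rewrite divff ?normr_eq0// mul1r.
Qed.

(** The product of two standard densities depends only on the sum of squares, which an orthogonal
    map preserves. *)
Lemma normal_pdf01_rotation (a b y w : R) : a ^+ 2 + b ^+ 2 = 1 ->
  normal_pdf 0 1 (a * y + b * w) * normal_pdf 0 1 (b * y - a * w) =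
  normal_pdf 0 1 y * normal_pdf 0 1 w.
Proof.
move=> ab; rewrite !normal_pdfE ?oner_neq0// /normal_fun.
rewrite mulrACA -expRD [RHS]mulrACA -expRD; congr (_ * expR _).
rewrite !subr0 -!mulrDl; congr (_ / _).
transitivity (- (a ^+ 2 + b ^+ 2) * (y ^+ 2 + w ^+ 2)); first ring.
by rewrite ab; ring.
Qed.

(** The orthogonal change of variables is split into two affine ones on the line: first
    [z = (y - a t) / b] at fixed [t], then, after exchanging the integrals, [t = a y + b w] at fixed
    [y]. The Jacobians [|b^-1|] and [|b|] cancel. *)
Lemma ge0_integral_normal_prob_rotation (a b : R) (G : RM * RM -> \bar R) :
  a ^+ 2 + b ^+ 2 = 1 -> b != 0 ->
  measurable_fun [set: RM * RM] G -> (forall p, 0 <= G p)%E ->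
  (\int[normal_prob 0 1]_t \int[normal_prob 0 1]_z G (t, z) =
   \int[normal_prob 0 1]_y \int[normal_prob 0 1]_w
     G (a * y + b * w, b * y - a * w)%R)%E.
Proof.
move=> ab b0 mG G0.
have mphi : measurable_fun [set: RM] (fun x : RM => (normal_pdf 0 1 x)%:E).
  by apply/measurable_EFinP; exact: measurable_normal_pdf.
have phi0 (x : R) : (0 <= (normal_pdf 0 1 x)%:E)%E.
  by rewrite lee_fin normal_pdf_ge0.
have mlin (p q : R) : measurable_fun [set: RM * RM] (fun x : RM * RM => p * x.1 + q * x.2 : RM).
  by apply: measurable_funD; exact: measurable_funM.
(* The integrand in the variables [(t, y)] after the first substitution, with both densities and the
   first Jacobian included. *)
pose K (p : RM * RM) : \bar R := (`|b^-1|%:E * (G (p.1, - (b^-1 * a) * p.1 + b^-1 * p.2)%R *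
  (normal_pdf 0 1 (- (b^-1 * a) * p.1 + b^-1 * p.2))%:E) * (normal_pdf 0 1 p.1)%:E)%E.
have K0 p : (0 <= K p)%E by rewrite /K !mule_ge0// ?lee_fin.
have mK : measurable_fun [set: RM * RM] K.
  apply: emeasurable_funM; last exact: (measurableT_comp mphi measurable_fst).
  apply: emeasurable_funM => //; apply: emeasurable_funM.
    exact: (measurableT_comp mG (measurable_fun_pair measurable_fst
      (mlin (- (b^-1 * a)) b^-1))).
  exact: (measurableT_comp mphi (mlin (- (b^-1 * a)) b^-1)).
transitivity (\int[mu]_t \int[mu]_y K (t, y))%E.
  rewrite ge0_integral_normal_prob; last 2 first.
  - exact: measurable_fun_fubini_tonelli_F.
  - by move=> t; exact: integral_ge0.
  apply: eq_integral => t _.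
  have mGt : measurable_fun [set: RM] (fun z : RM => G (t, z)) by exact: measurableT_comp.
  rewrite ge0_integral_normal_prob//.
  rewrite (@ge0_integral_affine b^-1 (- (b^-1 * a) * t)) ?invr_eq0//; last 2 first.
  - exact: emeasurable_funM.
  - by move=> z; rewrite mule_ge0.
  have ml : measurable_fun [set: RM] (fun x : RM => b^-1 * x + - (b^-1 * a) * t : RM).
    by apply: measurable_funD => //; exact: measurable_funM.
  have mJ : measurable_fun [set: RM] (fun y : RM =>
      G (t, (b^-1 * y + - (b^-1 * a) * t)%R) *
      (normal_pdf 0 1 (b^-1 * y + - (b^-1 * a) * t))%:E)%E.
    apply: emeasurable_funM; first exact: (measurableT_comp mGt ml).
    exact: (measurableT_comp mphi ml).
  rewrite -(ge0_integralZl mu measurableT mJ)//; last first.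
    by move=> z _; rewrite mule_ge0.
  have mI : measurable_fun [set: RM] (fun y : RM => `|b^-1|%:E *
      (G (t, (b^-1 * y + - (b^-1 * a) * t)%R) *
       (normal_pdf 0 1 (b^-1 * y + - (b^-1 * a) * t))%:E))%E.
    exact: emeasurable_funM.
  have I0 (y : RM) : [set: RM] y -> (0 <= `|b^-1|%:E *
      (G (t, (b^-1 * y + - (b^-1 * a) * t)%R) *
       (normal_pdf 0 1 (b^-1 * y + - (b^-1 * a) * t))%:E))%E.
    by move=> _; rewrite !mule_ge0.
  rewrite -(ge0_integralZr mu measurableT mI I0 (phi0 t)).
  by apply: eq_integral => y _; rewrite /K /= [in RHS]addrC.
rewrite (fubini_tonelli _ mK K0).
pose H (p : RM * RM) := G (a * p.1 + b * p.2, b * p.1 - a * p.2).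
have mH : measurable_fun [set: RM * RM] H.
  have := measurableT_comp mG (measurable_fun_pair (mlin a b) (mlin b (- a))).
  by apply: eq_measurable_fun => p _; rewrite /H/= mulNr.
rewrite ge0_integral_normal_prob; last 2 first.
- exact: (measurable_fun_fubini_tonelli_F H mH (fun=> G0 _)).
- by move=> y; apply: integral_ge0 => w _; exact: G0.
apply: eq_integral => y _.
have mHy : measurable_fun [set: RM] (fun w : RM => H (y, w)) by exact: measurableT_comp.
rewrite (@ge0_integral_affine b (a * y))//; last exact: measurableT_comp.
have mKy : measurable_fun [set: RM] (fun w : RM => K ((b * w + a * y)%R, y)).
  apply: (@measurableT_comp _ _ _ _ _ _ (fun t => K (t, y))).
    exact: measurableT_comp.
  exact: measurable_affine.
rewrite -(ge0_integralZl mu measurableT mKy (fun _ _ => K0 _)); last first.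
  by rewrite lee_fin.
have mHphi : measurable_fun [set: RM] (fun w : RM => H (y, w) * (normal_pdf 0 1 w)%:E)%E.
  exact: emeasurable_funM.
rewrite (ge0_integral_normal_prob 0 1 mHy (fun=> G0 _)).
have Hphi0 (w : RM) : [set: RM] w -> (0 <= H (y, w) * (normal_pdf 0 1 w)%:E)%E.
  by move=> _; apply: mule_ge0; [exact: G0|exact: phi0].
rewrite -(ge0_integralZr mu measurableT mHphi Hphi0 (phi0 y)).
apply: eq_integral => w _; rewrite /K /H/=.
have e1 : b * w + a * y = a * y + b * w by rewrite addrC.
(* At [t = a y + b w] the former [z = (y - a t) / b] becomes [b y - a w], by [a^2 + b^2 = 1]. *)
have e2 : - (b^-1 * a) * (b * w + a * y) + b^-1 * y = b * y - a * w.
  transitivity (b^-1 * (1 - a ^+ 2) * y - a * w); first by field.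
  by rewrite -ab addrAC subrr add0r expr2 mulrA mulVf// mul1r.
rewrite e2 e1; have := normal_pdf01_rotation y w ab.
have : `|b| * `|b^-1| = 1 by rewrite normfV divff// normr_eq0.
move: (normal_pdf 0 1 _) (normal_pdf 0 1 _) (normal_pdf 0 1 y) (normal_pdf 0 1 w).
move: (`|b|) (`|b^-1|) (G _) => u v g p q r s uv pq.
rewrite !muleA -EFinM uv mul1e -!muleA -!EFinM; congr (_ * _%:E)%E.
by rewrite mulrC pq mulrC.
Qed.

(** The integrand is the density of N(m, s^2) divided by that of N(0, 1). *)
Lemma integral_normal_likelihood (m s : R) : 0 < s ->
  (\int[normal_prob 0 1]_y
     (expR (y ^+ 2 / 2 - (y - m) ^+ 2 / (2 * s ^+ 2)) / s)%:E = 1)%E.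
Proof.
move=> s0; rewrite ge0_integral_normal_prob//; last 2 first.
- apply/measurable_EFinP; apply: measurable_funM => //.
  apply: measurableT_comp => //; apply: measurable_funB; apply: measurable_funM => //.
  by apply: measurable_funX; exact: measurable_funB.
- by move=> x; rewrite lee_fin divr_ge0// ?expR_ge0// ltW.
rewrite -[RHS](integral_normal_pdf m s); apply: eq_integral => y _.
rewrite -EFinM !normal_pdfE ?oner_neq0 ?gt_eqF// /normal_peak /normal_fun.
congr EFin.
have <- : expR (y ^+ 2 / 2 - (y - m) ^+ 2 / (2 * s ^+ 2)) *
    expR (- (y - 0) ^+ 2 / (1 ^+ 2 *+ 2)) = expR (- (y - m) ^+ 2 / (s ^+ 2 *+ 2)).
  by rewrite -expRD; congr expR; field; rewrite gt_eqF.
have <- : (Num.sqrt (1 ^+ 2 * pi *+ 2))^-1 / s = (Num.sqrt (s ^+ 2 * pi *+ 2))^-1.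
  rewrite -[in RHS]mulrnAr sqrtrM ?sqr_ge0// sqrtr_sqr expr1n mul1r invfM.
  by rewrite gtr0_norm// mulrC.
by ring.
Qed.

End one_dimensional.


(** * Normal vectors *)

Lemma integral_cst_probability {R : realType} d (T : measurableType d)
    (P : probability T R) (c : \bar R) : (\int[P]_x c = c)%E.
Proof.
apply: etrans (integral_cst P measurableT c) _.
apply: etrans (congr1 (fun u => c * u)%E (probability_setT P)) _.
exact: mule1.
Qed.

Section normal_vectors.
Context {R : realType}.
Local Notation RM := (measurableTypeR R).

(** Scaling by [a] is written [lincomb a 0 t t], and negation [lincomb 0 (-1) w w], so that one
    measurability lemma serves all cases. *)
Definition lincomb n (a b : R) (u v : n.-tuple R) : n.-tuple R :=
  [tuple a * tnth u i + b * tnth v i | i < n].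

Lemma lincomb_cons n (a b : R) (x y : R) (u v : n.-tuple R) :
  lincomb a b (tuple_cons (x, u)) (tuple_cons (y, v)) =
  tuple_cons (a * x + b * y, lincomb a b u v).
Proof.
apply: eq_from_tnth => i; rewrite tnth_mktuple.
by case: (unliftP ord0 i) => [j ->|->]; rewrite /tuple_cons/= !(tnthS, tnth0)// tnth_mktuple.
Qed.

Lemma tuple_cons_eta n (t : n.+1.-tuple R) :
  t = tuple_cons (thead t, [tuple of behead t]).
Proof. exact: tuple_eta. Qed.

Lemma measurable_lincomb d (T : measurableType d) n (a b : R)
    (f g : T -> n.-tuple R) :
  measurable_fun [set: T] f -> measurable_fun [set: T] g ->
  measurable_fun [set: T] (fun x => lincomb a b (f x) (g x)).
Proof.
move=> mf mg; apply/measurable_fun_tnthP => i.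
have m (h : T -> n.-tuple R) : measurable_fun [set: T] h ->
    measurable_fun [set: T] (fun x => tnth (h x) i).
  by move=> mh; exact: (measurableT_comp (measurable_tnth i) mh).
rewrite (_ : _ \o _ = fun x => a * tnth (f x) i + b * tnth (g x) i); last first.
  by apply/funext => x /=; rewrite tnth_mktuple.
by apply: measurable_funD; apply: measurable_funM => //; exact: m.
Qed.

Definition std_normal_vec n : probability (n.-tuple R) R :=
  normal_vec 1 (nseq_tuple n 0).

Lemma ge0_integral_normal_vecS (s : R) n (theta : n.+1.-tuple R)
    (F : n.+1.-tuple R -> \bar R) :
  measurable_fun [set: n.+1.-tuple R] F -> (forall x, 0 <= F x)%E ->
  (\int[normal_vec s theta]_x F x =
   \int[normal_prob (thead theta) s]_x
     \int[normal_vec s [tuple of behead theta]]_y F (tuple_cons (x, y)))%E.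
Proof.
move=> mF F0.
rewrite (ge0_integral_distribution (@tuple_cons R n) mF F0).
have mFc : measurable_fun [set: RM * n.-tuple R] (F \o @tuple_cons R n).
  exact: (measurableT_comp mF (@measurable_tuple_cons R n)).
by rewrite (fubini_tonelli1 _ mFc (fun=> F0 _)).
Qed.

Lemma ge0_integral_std_normal_vecS n (F : n.+1.-tuple R -> \bar R) :
  measurable_fun [set: n.+1.-tuple R] F -> (forall x, 0 <= F x)%E ->
  (\int[std_normal_vec n.+1]_x F x =
   \int[normal_prob 0 1]_x \int[std_normal_vec n]_y F (tuple_cons (x, y)))%E.
Proof.
move=> mF F0; rewrite /std_normal_vec (ge0_integral_normal_vecS _ _ mF F0).
have -> : thead (nseq_tuple n.+1 (0 : R)) = 0 by [].
by have -> : [tuple of behead (nseq_tuple n.+1 (0 : R))] = nseq_tuple n 0 by exact: val_inj.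
Qed.

Lemma ge0_integral_std_normal_vec0 (F : 0.-tuple R -> \bar R) :
  (forall x, 0 <= F x)%E -> (\int[std_normal_vec 0]_x F x = F [tuple])%E.
Proof.
move=> F0.
have -> : F = cst (F [tuple]) by apply/funext => t; rewrite (tuple0 t).
exact: integral_cst_probability.
Qed.

Lemma ge0_integral_normal_vec_affine (s : R) n (theta : n.-tuple R)
    (F : n.-tuple R -> \bar R) : s != 0 ->
  measurable_fun [set: n.-tuple R] F -> (forall x, 0 <= F x)%E ->
  (\int[normal_vec s theta]_x F x =
   \int[std_normal_vec n]_z F (lincomb 1 s theta z))%E.
Proof.
move=> s0; elim: n theta F => [|n IH] theta F mF F0.
  rewrite ge0_integral_std_normal_vec0//.
  have -> : F = cst (F [tuple]) by apply/funext => t; rewrite (tuple0 t).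
  exact: integral_cst_probability.
have mFc : measurable_fun [set: RM * n.-tuple R] (F \o @tuple_cons R n).
  exact: (measurableT_comp mF (@measurable_tuple_cons R n)).
apply: etrans (ge0_integral_normal_vecS s theta mF F0) _.
pose th' : n.-tuple R := [tuple of behead theta].
pose K (p : RM * n.-tuple R) := F (tuple_cons (p.1, lincomb 1 s th' p.2)).
transitivity (\int[normal_prob (thead theta) s]_x
    \int[std_normal_vec n]_z K (x, z))%E.
  apply: eq_integral => x _.
  by apply: (IH th' _ (measurableT_comp mFc (measurable_pair1 x))) => y; exact: F0.
have mK : measurable_fun [set: RM * n.-tuple R] K.
  apply: (measurableT_comp mFc); apply: measurable_fun_pair => //.
  exact: measurable_lincomb.
apply: etrans (ge0_integral_normal_prob_affine _ s0
  (measurable_fun_fubini_tonelli_F K mK (fun=> F0 _)) _) _.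
  by move=> x; apply: integral_ge0 => z _; exact: F0.
have mFz : measurable_fun [set: n.+1.-tuple R] (fun z => F (lincomb 1 s theta z)).
  by apply: (measurableT_comp mF); exact: measurable_lincomb.
apply: etrans (esym (ge0_integral_std_normal_vecS mFz (fun=> F0 _))).
apply: eq_integral => x _; apply: eq_integral => z _.
by rewrite /K/= [in RHS](tuple_cons_eta theta) lincomb_cons mul1r.
Qed.

Lemma measurable_fun_tuple_cons d (T : measurableType d) n (f : T -> RM) (g : T -> n.-tuple R) :
  measurable_fun [set: T] f -> measurable_fun [set: T] g ->
  measurable_fun [set: T] (fun x => tuple_cons (f x, g x)).
Proof. by move=> mf mg; exact: measurable_cons. Qed.

(** Tonelli moves the first coordinate of [z] outside the remaining coordinates of [t]. This makes
    the two first coordinates adjacent, ready for a rotation of the plane. *)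
Lemma ge0_integral2_std_normal_vecS n (G : n.+1.-tuple R * n.+1.-tuple R -> \bar R) :
  measurable_fun [set: n.+1.-tuple R * n.+1.-tuple R] G -> (forall p, 0 <= G p)%E ->
  (\int[std_normal_vec n.+1]_t \int[std_normal_vec n.+1]_z G (t, z) =
   \int[normal_prob 0 1]_t0 \int[normal_prob 0 1]_z0
    \int[std_normal_vec n]_t \int[std_normal_vec n]_z
      G (tuple_cons (t0, t), tuple_cons (z0, z)))%E.
Proof.
move=> mG G0.
apply: etrans (ge0_integral_std_normal_vecS
  (measurable_fun_fubini_tonelli_F G mG G0) _) _.
  by move=> t; apply: integral_ge0 => z _; exact: G0.
apply: eq_integral => t0 _.
transitivity (\int[std_normal_vec n]_t \int[normal_prob 0 1]_z0
    \int[std_normal_vec n]_z G (tuple_cons (t0, t), tuple_cons (z0, z)))%E.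
  apply: eq_integral => t _; apply: ge0_integral_std_normal_vecS => //.
  exact: (measurableT_comp mG (measurable_pair1 _)).
pose K (p : (n.-tuple R * RM) * n.-tuple R) :=
  G (tuple_cons (t0, p.1.1), tuple_cons (p.1.2, p.2)).
have mK : measurable_fun [set: (n.-tuple R * RM) * n.-tuple R] K.
  apply: (measurableT_comp mG); apply: measurable_fun_pair.
    apply: measurable_fun_tuple_cons => //.
    exact: (measurableT_comp measurable_fst measurable_fst).
  apply: measurable_fun_tuple_cons => //.
  exact: (measurableT_comp measurable_snd measurable_fst).
apply: (fubini_tonelli _ (measurable_fun_fubini_tonelli_F K mK (fun=> G0 _))).
by move=> p; apply: integral_ge0 => z _; exact: G0.
Qed.

(** The map acts separately on each pair of coordinates of equal index: the planar case treats the
    first pair, induction the others. *)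
Lemma ge0_integral_std_normal_vec_rotation n (a b : R)
    (G : n.-tuple R * n.-tuple R -> \bar R) :
  a ^+ 2 + b ^+ 2 = 1 -> b != 0 ->
  measurable_fun [set: n.-tuple R * n.-tuple R] G -> (forall p, 0 <= G p)%E ->
  (\int[std_normal_vec n]_t \int[std_normal_vec n]_z G (t, z) =
   \int[std_normal_vec n]_y \int[std_normal_vec n]_w
     G (lincomb a b y w, lincomb b (- a) y w))%E.
Proof.
move=> ab b0; elim: n G => [|n IH] G mG G0.
  have E (H : 0.-tuple R * 0.-tuple R -> \bar R) : (forall p, 0 <= H p)%E ->
      (\int[std_normal_vec 0]_t \int[std_normal_vec 0]_z H (t, z) = H ([tuple], [tuple]))%E.
    move=> H0; apply: etrans (ge0_integral_std_normal_vec0 _) _.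
      by move=> t; apply: integral_ge0 => z _; exact: H0.
    by apply: ge0_integral_std_normal_vec0 => z; exact: H0.
  apply: etrans (E G G0) (esym (etrans (E (fun p => G (lincomb a b p.1 p.2,
    lincomb b (- a) p.1 p.2)) (fun=> G0 _)) _)).
  by congr (G (_, _)); rewrite tuple0.
apply: etrans (ge0_integral2_std_normal_vecS mG G0) _.
pose G' p := G (lincomb a b p.1 p.2, lincomb b (- a) p.1 p.2).
have mG' : measurable_fun [set: n.+1.-tuple R * n.+1.-tuple R] G'.
  by apply: (measurableT_comp mG); apply: measurable_fun_pair; exact: measurable_lincomb.
apply: etrans (esym (ge0_integral2_std_normal_vecS mG' (fun=> G0 _))).
pose K (p : (RM * RM) * n.-tuple R * n.-tuple R) :=
  G (tuple_cons (p.1.1.1, p.1.2), tuple_cons (p.1.1.2, p.2)).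
have mK : measurable_fun [set: (RM * RM) * n.-tuple R * n.-tuple R] K.
  have m11 : measurable_fun [set: (RM * RM) * n.-tuple R * n.-tuple R] (fun p => p.1.1).
    exact: (measurableT_comp measurable_fst measurable_fst).
  apply: (measurableT_comp mG); apply: measurable_fun_pair.
    apply: measurable_fun_tuple_cons.
      exact: (measurableT_comp measurable_fst m11).
    exact: (measurableT_comp measurable_snd measurable_fst).
  apply: measurable_fun_tuple_cons => //.
  exact: (measurableT_comp measurable_snd m11).
have mK1 := measurable_fun_fubini_tonelli_F (m2 := std_normal_vec n) K mK (fun=> G0 _).
have K10 p : (0 <= fubini_F (std_normal_vec n) K p)%E.
  by apply: integral_ge0 => z _; exact: G0.
have mK2 := measurable_fun_fubini_tonelli_F (m2 := std_normal_vec n) _ mK1 K10.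
have K20 p : (0 <= fubini_F (std_normal_vec n) (fubini_F (std_normal_vec n) K) p)%E.
  by apply: integral_ge0 => z _; exact: K10.
apply: etrans (ge0_integral_normal_prob_rotation ab b0 mK2 K20) _.
apply: eq_integral => y0 _; apply: eq_integral => w0 _.
have mc : measurable_fun [set: n.-tuple R * n.-tuple R] (fun p => G
    (tuple_cons (a * y0 + b * w0, p.1), tuple_cons (b * y0 - a * w0, p.2))).
  by apply: (measurableT_comp mG); apply: measurable_fun_pair;
    apply: measurable_fun_tuple_cons.
apply: etrans (IH _ mc (fun=> G0 _)) _.
apply: eq_integral => y _; apply: eq_integral => w _.
by rewrite /G'/= !lincomb_cons mulNr.
Qed.

(** The integrand is the likelihood ratio of N(m, s^2 I_n) with respect to N(0, I_n), a product of
    one-dimensional ratios. *)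
Lemma integral_std_normal_vec_likelihood n (m : n.-tuple R) (s : R) : 0 < s ->
  (\int[std_normal_vec n]_y
     (expR (\sum_(i < n) (tnth y i ^+ 2 / 2 -
        (tnth y i - tnth m i) ^+ 2 / (2 * s ^+ 2))) / s ^+ n)%:E = 1)%E.
Proof.
move=> s0.
have mE k (m' : k.-tuple R) : measurable_fun [set: k.-tuple R] (fun y =>
    (expR (\sum_(i < k) (tnth y i ^+ 2 / 2 -
      (tnth y i - tnth m' i) ^+ 2 / (2 * s ^+ 2))) / s ^+ k)%:E).
  apply/measurable_EFinP; apply: measurable_funM => //.
  apply: measurableT_comp => //; apply: measurable_sum => i.
  by apply: measurable_funB; apply: measurable_funM => //; apply: measurable_funX;
    try apply: measurable_funB => //; exact: measurable_tnth.
have E0 k (m' y : k.-tuple R) : (0 <= (expR (\sum_(i < k) (tnth y i ^+ 2 / 2 -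
      (tnth y i - tnth m' i) ^+ 2 / (2 * s ^+ 2))) / s ^+ k)%:E)%E.
  by rewrite lee_fin divr_ge0 ?expR_ge0// exprn_ge0// ltW.
elim: n m => [|n IH] m.
  apply: etrans (ge0_integral_std_normal_vec0 (E0 _ m)) _.
  by rewrite big_ord0 expR0 expr0 divr1.
apply: etrans (ge0_integral_std_normal_vecS (mE _ m) (E0 _ m)) _.
rewrite -[RHS](integral_normal_likelihood (thead m) s0).
apply: eq_integral => x _.
set c := (_ / s)%R.
have c0 : (0 <= c%:E)%E by rewrite lee_fin divr_ge0 ?expR_ge0// ltW.
pose m' : n.-tuple R := [tuple of behead m].
apply: etrans (_ : (c%:E * 1)%E = _); last by rewrite mule1.
rewrite -(IH m') -(ge0_integralZl _ measurableT (mE _ m') (fun y _ => E0 _ m' y) c0).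
apply: eq_integral => y _; rewrite -EFinM; congr EFin.
rewrite [in LHS](tuple_cons_eta m) big_ord_recl expRD !tnth0 /c.
rewrite [s ^+ n.+1]exprS [(s * _)^-1]invfM [RHS]mulrACA; congr (_ * expR _ * _).
by apply: eq_bigr => i _; rewrite /tuple_cons/= !tnthS.
Qed.

End normal_vectors.

(** * Shannon's lower bound *)

Section quantization.
Context {R : realType}.

Definition normsq n (u : n.-tuple R) : R := \sum_(i < n) tnth u i ^+ 2.

Definition sqdist n (u v : n.-tuple R) : R :=
  \sum_(i < n) (tnth u i - tnth v i) ^+ 2.

Lemma normsq_ge0 n (u : n.-tuple R) : 0 <= normsq u.
Proof. by apply: sumr_ge0 => i _; exact: sqr_ge0. Qed.

Lemma sqdist_ge0 n (u v : n.-tuple R) : 0 <= sqdist u v.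
Proof. by apply: sumr_ge0 => i _; exact: sqr_ge0. Qed.

Lemma measurable_sqdist d (T : measurableType d) n (f g : T -> n.-tuple R) :
  measurable_fun [set: T] f -> measurable_fun [set: T] g ->
  measurable_fun [set: T] (fun x => sqdist (f x) (g x)).
Proof.
move=> mf mg; apply: measurable_sum => i; apply: measurable_funX.
apply: measurable_funB.
  exact: (measurableT_comp (measurable_tnth i) mf).
exact: (measurableT_comp (measurable_tnth i) mg).
Qed.

Lemma measurable_normsq n : measurable_fun [set: n.-tuple R] (@normsq n).
Proof.
by apply: measurable_sum => i; apply: measurable_funX; exact: measurable_tnth.
Qed.

Lemma measurable_codebook n N (e : n.-tuple R -> 'I_N) (f : 'I_N -> n.-tuple R) :
  (forall k, measurable (e @^-1` [set k])) ->
  measurable_fun [set: n.-tuple R] (f \o e).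
Proof.
move=> me _ A mA; rewrite setTI.
rewrite (_ : _ @^-1` _ = \bigcup_(k in [set k | A (f k)]) (e @^-1` [set k])).
  by apply: fin_bigcup_measurable => // k _; exact: me.
by apply/seteqP; split => [x Ax|x [k /= Ak ek]]; [exists (e x)|rewrite /= ek].
Qed.

Lemma bernoulli_ge (x : R) n : 0 <= x -> 1 + n%:R * x <= (1 + x) ^+ n.
Proof.
move=> x0; elim: n => [|n IH]; first by rewrite mul0r addr0 expr0.
rewrite exprSr -natr1; apply: le_trans (ler_wpM2r _ IH); last by rewrite addr_ge0.
have : 0 <= n%:R * (x * x) by rewrite mulr_ge0// mulr_ge0.
by nra.
Qed.

(** An elementary form of the limit [t -> 0]; it yields the second moment of a normal vector and the
    final limit [r -> 1]. *)
Lemma le_of_le_mul1D (x y C : R) : 0 <= x -> 0 <= C ->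
  (forall t, 0 < t -> t <= 1 -> y <= x * (1 + C * t)) -> y <= x.
Proof.
move=> x0 C0 H; rewrite leNgt; apply/negP => xy.
(* The denominator ensures both [t <= 1] and [x * C * t < y - x], which contradicts the hypothesis
   at [t]. *)
pose t := (y - x) / (y - x + 2 * x * C + 1).
have d0 : 0 < y - x + 2 * x * C + 1.
  have : 0 <= x * C by exact: mulr_ge0.
  by move: xy; lra.
have t0 : 0 < t by rewrite divr_gt0// subr_gt0.
have t1 : t <= 1.
  rewrite ler_pdivrMr// mul1r; have : 0 <= x * C by exact: mulr_ge0.
  by lra.
have := H t t0 t1; rewrite leNgt => /negP; apply.
have tE : t * (y - x + 2 * x * C + 1) = y - x by rewrite divfK// gt_eqF.
have p1 : 0 <= x * C * t := mulr_ge0 (mulr_ge0 x0 C0) (ltW t0).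
have p2 : 0 <= t * (y - x) by apply: mulr_ge0 (ltW t0) _; rewrite subr_ge0 ltW.
by move: tE p1 p2 t0; lra.
Qed.

(** The likelihood ratio of standard deviation [1 / (1 + t)] is [(1 + t)^n exp (- l |z|^2)] with
    [l = t (1 + t / 2)]. Integrating [exp (- l |z|^2) >= 1 - l |z|^2] bounds the second moment
    below, and [t] then tends to 0. *)
Lemma integral_std_normal_vec_normsq_ge n :
  (n%:R%:E <= \int[@std_normal_vec R n]_z (normsq z)%:E)%E.
Proof.
set I := integral _ _ _.
have : (0 <= I)%E by apply: integral_ge0 => z _; rewrite lee_fin normsq_ge0.
case EI : I => [r| |]//; last by move=> _; rewrite leey.
rewrite !lee_fin => r0.
(* The constant comes from [(1 + n t) (1 + t / 2) <= 1 + (3 n / 2 + 1 / 2) t] for [t <= 1]. *)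
apply: (@le_of_le_mul1D _ _ (n%:R * (3 / 2) + 2^-1)) => // t t0 t1.
pose l : R := t * (1 + t / 2).
have l0 : 0 < l by rewrite mulr_gt0// addr_gt0// divr_gt0.
have s0 : 0 < (1 + t)^-1 by rewrite invr_gt0 addr_gt0.
have p0 : 0 < (1 + t) ^+ n by rewrite exprn_gt0// addr_gt0.
pose L (y : n.-tuple R) := expR (\sum_(i < n) (tnth y i ^+ 2 / 2 -
  (tnth y i - tnth (nseq_tuple n (0 : R)) i) ^+ 2 / (2 * (1 + t)^-1 ^+ 2))) / (1 + t)^-1 ^+ n.
have LE y : L y = expR (- (l * normsq y)) * (1 + t) ^+ n.
  rewrite /L [(1 + t)^-1 ^+ n]exprVn invrK; congr (expR _ * _).
  rewrite mulr_sumr -sumrN; apply: eq_bigr => i _.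
  rewrite tnth_nseq subr0 /l; field.
  by rewrite gt_eqF// addr_gt0.
have L0 y : 0 <= L y by rewrite LE mulr_ge0// ?expR_ge0// ltW.
have mN := @measurable_normsq n.
have mL : measurable_fun [set: n.-tuple R] L.
  rewrite (_ : L = fun y => expR (- (l * normsq y)) * (1 + t) ^+ n); last exact/funext.
  apply: measurable_funM => //; apply: measurableT_comp => //.
  by apply: measurableT_comp => //; exact: measurable_funM.
have iL := integral_std_normal_vec_likelihood (nseq_tuple n (0 : R)) s0.
have : (((1 + t) ^+ n)%:E <= ((1 + t) ^+ n * l)%:E * I + 1)%E.
  rewrite -[X in (_ + X)%E]iL -(ge0_integralZl _ measurableT)//; last 3 first.
  - exact/measurable_EFinP.
  - by move=> z _; rewrite lee_fin normsq_ge0.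
  - by rewrite lee_fin; exact: mulr_ge0 (ltW p0) (ltW l0).
  rewrite -(ge0_integralD _ measurableT)//; last 4 first.
  - move=> z _; rewrite lee_fin; apply: mulr_ge0 (normsq_ge0 z).
    exact: mulr_ge0 (ltW p0) (ltW l0).
  - by apply/measurable_EFinP; exact: measurable_funM.
  - by move=> z _; rewrite lee_fin; exact: L0.
  - exact/measurable_EFinP.
  rewrite -[leLHS](integral_cst_probability (std_normal_vec n)).
  apply: ge0_le_integral => //.
  - by move=> z _; rewrite lee_fin ltW.
  - by apply: emeasurable_funD; apply/measurable_EFinP => //; exact: measurable_funM.
  move=> z _; rewrite -EFinD lee_fin -/(L z) LE.
  have := expR_ge1Dx (- (l * normsq z)).
  by nra.
rewrite EI -EFinM -EFinD lee_fin => H.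
have B := bernoulli_ge n (ltW t0).
(* [H] says [(1 + t)^n (1 - l r) <= 1]; when [l r < 1], Bernoulli's inequality replaces the power by
   [1 + n t]. *)
have : n%:R * t <= (1 + n%:R * t) * (l * r).
  have n0 : 0 <= n%:R * t by rewrite mulr_ge0// ltW.
  have [lr|lr] := leP 1 (l * r); first by nra.
  have : 0 <= ((1 + t) ^+ n - (1 + n%:R * t)) * (1 - l * r).
    by rewrite mulr_ge0// subr_ge0// ltW.
  by move: H; rewrite -mulrA; move: ((1 + t) ^+ n) => p; lra.
move: (n%:R : R) (ler0n R n) => m m0 {}H.
have : t * m <= t * (r * (1 + (m * (3 / 2) + 2^-1) * t)).
  move: H; rewrite /l; have : 0 <= r * m * t * t * (1 - t).
    by rewrite !mulr_ge0 ?subr_ge0// ltW.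
  by lra.
by rewrite ler_pM2l.
Qed.

(** The case [a = 0], [b = -1] of the rotation, for a function of the first vector only. *)
Lemma std_normal_vec_symmetric n (F : n.-tuple R -> \bar R) :
  measurable_fun [set: n.-tuple R] F -> (forall x, 0 <= F x)%E ->
  (\int[std_normal_vec n]_z F z = \int[std_normal_vec n]_w F (lincomb 0 (-1) w w))%E.
Proof.
move=> mF F0.
have ab : 0 ^+ 2 + (-1) ^+ 2 = 1 :> R by rewrite expr0n sqrrN expr1n add0r.
have b0 : -1 != 0 :> R by rewrite oppr_eq0 oner_eq0.
have mG : measurable_fun [set: n.-tuple R * n.-tuple R] (fun p => F p.1).
  exact: (measurableT_comp mF measurable_fst).
have := ge0_integral_std_normal_vec_rotation ab b0 mG (fun=> F0 _).
move=> E; transitivity (\int[std_normal_vec n]_t \int[std_normal_vec n]_z F t)%E.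
  by apply: eq_integral => t _; rewrite integral_cst_probability.
apply: etrans E _.
transitivity (\int[std_normal_vec n]_y \int[std_normal_vec n]_w F (lincomb 0 (-1) w w))%E;
  last exact: integral_cst_probability.
apply: eq_integral => y _; apply: eq_integral => w _; congr F.
by apply: eq_from_tnth => i; rewrite !tnth_mktuple !mul0r.
Qed.

(* Averaging over [w] and [- w] removes the cross term without any
   integrability argument. *)
Lemma integral_sqdist_lincomb_ge n (a b : R) (y c : n.-tuple R) :
  ((\sum_(i < n) (a * tnth y i - tnth c i) ^+ 2 + b ^+ 2 * n%:R)%:E <=
   \int[std_normal_vec n]_w (sqdist (lincomb a b y w) c)%:E)%E.
Proof.
set S := \sum_(i < n) _.
pose F (w : n.-tuple R) := (sqdist (lincomb a b y w) c)%:E.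
have mF : measurable_fun [set: n.-tuple R] F.
  apply/measurable_EFinP; apply: measurable_sqdist => //.
  exact: measurable_lincomb.
have F0 w : (0 <= F w)%E by rewrite lee_fin sqdist_ge0.
have mFN : measurable_fun [set: n.-tuple R] (fun w => F (lincomb 0 (-1) w w)).
  by apply: (measurableT_comp mF); exact: measurable_lincomb.
have mN := @measurable_normsq n.
have S0 : 0 <= S by apply: sumr_ge0 => i _; exact: sqr_ge0.
set I := integral _ _ _.
have : ((2 * (S + b ^+ 2 * n%:R))%:E <= I + I)%E.
  rewrite {2}/I (std_normal_vec_symmetric mF F0).
  rewrite -(ge0_integralD _ measurableT (fun w _ => F0 w) mF (fun w _ => F0 _) mFN).
  have -> : (\int[std_normal_vec n]_w (F w + F (lincomb 0 (-1) w w)) =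
      \int[std_normal_vec n]_w ((2 * S)%:E + (2 * b ^+ 2)%:E * (normsq w)%:E))%E.
    apply: eq_integral => w _; rewrite /F -EFinM -!EFinD; congr EFin.
    rewrite /S /sqdist /normsq !mulr_sumr -!big_split; apply: eq_bigr => i _ /=.
    by rewrite !tnth_mktuple; ring.
  rewrite (ge0_integralD _ measurableT)//; last 3 first.
  - by move=> w _; rewrite lee_fin mulr_ge0.
  - move=> w _; rewrite lee_fin; apply: mulr_ge0 (normsq_ge0 w).
    by rewrite mulr_ge0// sqr_ge0.
  - by apply/measurable_EFinP; exact: measurable_funM.
  rewrite (ge0_integralZl _ measurableT)//; last 3 first.
  - exact/measurable_EFinP.
  - by move=> w _; rewrite lee_fin normsq_ge0.
  - by rewrite lee_fin mulr_ge0// sqr_ge0.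
  rewrite integral_cst_probability mulrDr mulrA EFinD leeD2l// EFinM lee_wpmul2l//.
    by rewrite lee_fin mulr_ge0// sqr_ge0.
  exact: integral_std_normal_vec_normsq_ge.
move=> I2; have : (0 <= I)%E by apply: integral_ge0 => w _; exact: F0.
move: I2; case: I => [r| |]; [|by move=> _ _; exact: leey|by move=> _; rewrite leeNy_eq].
by rewrite -EFinD !lee_fin; lra.
Qed.

End quantization.

Section shannon.
Context {R : realType}.

(* [u = exp (|y|^2 / 2 - |y - f (e y)|^2 / (2 s^2))] is [s^n] times the
   likelihood ratio of N(f (e y), s^2) with respect to N(0, 1), hence is
   dominated by a sum of [N] functions of integral [s^n]; the bound follows by
   integrating [u >= 1 + ln u]. *)
Lemma integral_quantization_error_ge n N (s : R) (e : n.-tuple R -> 'I_N)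
    (f : 'I_N -> n.-tuple R) :
  (forall k, measurable (e @^-1` [set k])) -> 0 < s -> N%:R * s ^+ n <= 1 ->
  ((n%:R * s ^+ 2)%:E <= \int[std_normal_vec n]_y (sqdist y (f (e y)))%:E)%E.
Proof.
move=> me s0 Ns.
pose L k (y : n.-tuple R) := expR (\sum_(i < n) (tnth y i ^+ 2 / 2 -
  (tnth y i - tnth (f k) i) ^+ 2 / (2 * s ^+ 2))) / s ^+ n.
have L0 k y : (0 <= (L k y)%:E)%E.
  by rewrite lee_fin divr_ge0 ?expR_ge0// exprn_ge0// ltW.
have mL k : measurable_fun [set: n.-tuple R] (fun y => (L k y)%:E).
  apply/measurable_EFinP; apply: measurable_funM => //.
  apply: measurableT_comp => //; apply: measurable_sum => i.
  by apply: measurable_funB; apply: measurable_funM => //; apply: measurable_funX;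
    try apply: measurable_funB => //; exact: measurable_tnth.
have iL k : (\int[std_normal_vec n]_y (L k y)%:E = 1)%E.
  exact: integral_std_normal_vec_likelihood.
pose S y := (\sum_(k <- enum 'I_N) (L k y)%:E)%E.
have S0 y : (0 <= S y)%E by apply: sume_ge0 => k _.
have mS : measurable_fun [set: n.-tuple R] S by exact: emeasurable_sum.
have iS : (\int[std_normal_vec n]_y S y = N%:R%:E)%E.
  rewrite (ge0_integral_sum _ measurableT mL (fun k y _ => L0 k y)).
  rewrite (eq_bigr (fun=> 1%E)) => [|k _]; last exact: iL.
  by rewrite sumEFin big_const_seq count_predT -cardE card_ord iter_addr_0.
have sn0 : 0 < s ^+ n by rewrite exprn_gt0.
pose D y := sqdist y (f (e y)).
have mD : measurable_fun [set: n.-tuple R] (fun y => (D y)%:E).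
  apply/measurable_EFinP; apply: measurable_sqdist => //.
  exact: measurable_codebook.
have D0 y : (0 <= (D y)%:E)%E by rewrite lee_fin sqdist_ge0.
have c0 : (0 <= ((2 * s ^+ 2)^-1)%:E)%E.
  by rewrite lee_fin invr_ge0 mulr_ge0// sqr_ge0.
have sn0E : (0 <= (s ^+ n)%:E)%E by rewrite lee_fin ltW.
have mN : measurable_fun [set: n.-tuple R] (fun y => (normsq y)%:E).
  by apply/measurable_EFinP; exact: measurable_normsq.
have N0 (y : n.-tuple R) : (0 <= (normsq y)%:E)%E by rewrite lee_fin normsq_ge0.
have pointwise y : ((1 + 2^-1 * normsq y)%:E <=
    ((2 * s ^+ 2)^-1)%:E * (D y)%:E + (s ^+ n)%:E * S y)%E.
  apply: (@le_trans _ _ (((2 * s ^+ 2)^-1)%:E * (D y)%:E +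
      (s ^+ n)%:E * (L (e y) y)%:E)%E); last first.
    apply: leeD2l; apply: lee_wpmul2l => //.
    rewrite /S (bigD1_seq (e y)) ?mem_enum ?enum_uniq//=.
    by rewrite leeDl// sume_ge0.
  have sL : s ^+ n * L (e y) y = expR (normsq y / 2 - D y / (2 * s ^+ 2)).
    by rewrite /L [LHS]mulrC divfK ?gt_eqF// sumrB -!mulr_suml.
  rewrite -!EFinM -EFinD lee_fin sL.
  have := expR_ge1Dx (normsq y / 2 - D y / (2 * s ^+ 2)).
  by rewrite (mulrC _ (D y)) (mulrC _ (normsq y)); lra.
have mcD : measurable_fun [set: n.-tuple R] (fun y => ((2 * s ^+ 2)^-1)%:E * (D y)%:E)%E.
  exact: emeasurable_funM.
have msS : measurable_fun [set: n.-tuple R] (fun y => (s ^+ n)%:E * S y)%E.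
  exact: emeasurable_funM.
have mhN : measurable_fun [set: n.-tuple R] (fun y => (2^-1)%:E * (normsq y)%:E)%E.
  exact: emeasurable_funM.
have h0 : (0 <= (2^-1 : R)%:E)%E by rewrite lee_fin.
(* Integrating [pointwise]: on the left [|y|^2] has mean at least [n], and on the right [s^n S] has
   integral [s^n N <= 1]. *)
have : ((1 + 2^-1 * n%:R)%:E <= ((2 * s ^+ 2)^-1)%:E *
    (\int[std_normal_vec n]_y (D y)%:E) + 1)%E.
  apply: (@le_trans _ _ (\int[std_normal_vec n]_y (1 + (2^-1)%:E * (normsq y)%:E))%E).
    rewrite (ge0_integralD _ measurableT (fun _ _ => lee01) _
      (fun y _ => mule_ge0 h0 (N0 y)) mhN)//.
    rewrite integral_cst_probability (ge0_integralZl _ measurableT mN (fun y _ => N0 y) h0).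
    rewrite EFinD EFinM leeD2l// lee_wpmul2l//.
    exact: integral_std_normal_vec_normsq_ge.
  apply: (@le_trans _ _ (\int[std_normal_vec n]_y
      (((2 * s ^+ 2)^-1)%:E * (D y)%:E + (s ^+ n)%:E * S y))%E).
    apply: ge0_le_integral => [//|y _| | |y _].
    - by rewrite adde_ge0// mule_ge0.
    - exact: emeasurable_funD.
    - exact: emeasurable_funD.
    - exact: pointwise.
  rewrite (ge0_integralD _ measurableT (fun y _ => mule_ge0 c0 (D0 y)) mcD
    (fun y _ => mule_ge0 sn0E (S0 y)) msS).
  rewrite (ge0_integralZl _ measurableT mD (fun y _ => D0 y) c0).
  rewrite (ge0_integralZl _ measurableT mS (fun y _ => S0 y) sn0E) iS.
  by rewrite leeD2l// -EFinM lee_fin mulrC.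
have : (0 <= \int[std_normal_vec n]_y (D y)%:E)%E.
  by apply: integral_ge0 => y _; exact: D0.
case: (integral _ _ _) => [r| |]; [|by move=> _ _; exact: leey|by rewrite leeNy_eq].
move=> _; rewrite -EFinM -EFinD !lee_fin => H.
have : 2^-1 * n%:R <= r / (2 * s ^+ 2) by lra.
by rewrite ler_pdivlMr ?mulr_gt0 ?exprn_gt0//; lra.
Qed.

End shannon.

(** * Bayes risk *)

Section bayes_risk.
Context {R : realType}.

Lemma measurable_comp_lincomb n N (e : n.-tuple R -> 'I_N) (a : R) :
  (forall k, measurable (e @^-1` [set k])) ->
  forall k, measurable ((fun y => e (lincomb a 0 y y)) @^-1` [set k]).
Proof.
move=> me k; rewrite -[X in measurable X]setTI.
exact: (measurable_lincomb a 0 (@measurable_id _ _ _) (@measurable_id _ _ _)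
  measurableT (me k)).
Qed.

Lemma ge0_integral_sqdist_risk n N (sigma : R) (theta : n.-tuple R)
    (e : n.-tuple R -> 'I_N) (f : 'I_N -> n.-tuple R) : sigma != 0 ->
  (forall k, measurable (e @^-1` [set k])) ->
  (\int[normal_vec sigma theta]_x (sqdist theta (f (e x)))%:E =
   \int[std_normal_vec n]_z (sqdist theta (f (e (lincomb 1 sigma theta z))))%:E)%E.
Proof.
move=> s0 me.
have mF : measurable_fun [set: n.-tuple R] (fun x => (sqdist theta (f (e x)))%:E).
  apply/measurable_EFinP; apply: measurable_sqdist => //.
  exact: (measurable_codebook f me).
apply: (ge0_integral_normal_vec_affine theta s0 mF) => x.
by rewrite lee_fin sqdist_ge0.
Qed.

Lemma bayes_risk_ge n N (sigma tau s : R) (e : n.-tuple R -> 'I_N)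
    (f : 'I_N -> n.-tuple R) :
  0 < sigma -> 0 < tau -> 0 < s -> N%:R * s ^+ n <= 1 ->
  (forall k, measurable (e @^-1` [set k])) ->
  ((n%:R * (tau ^+ 2 * sigma ^+ 2 / (sigma ^+ 2 + tau ^+ 2) +
     tau ^+ 4 / (sigma ^+ 2 + tau ^+ 2) * s ^+ 2))%:E <=
   \int[std_normal_vec n]_t \int[normal_vec sigma (lincomb tau 0 t t)]_x
     (sqdist (lincomb tau 0 t t) (f (e x)))%:E)%E.
Proof.
move=> sg0 tau0 s0 Ns me.
pose rho := Num.sqrt (sigma ^+ 2 + tau ^+ 2).
have r20 : 0 < sigma ^+ 2 + tau ^+ 2 by rewrite addr_gt0// exprn_gt0.
have rho0 : 0 < rho by rewrite sqrtr_gt0.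
have rhoE : rho ^+ 2 = sigma ^+ 2 + tau ^+ 2 by rewrite sqr_sqrtr// ltW.
have rhoN0 : rho != 0 by rewrite gt_eqF.
(* With these coefficients [tau a + sigma b = rho] and [tau b - sigma a = 0], so the observation
   [tau t + sigma z] becomes [rho y], free of [w]. *)
pose a := tau / rho; pose b := sigma / rho.
have a0 : 0 < a by rewrite divr_gt0.
have b0 : b != 0 by rewrite mulf_neq0 ?invr_eq0// gt_eqF.
have ab : a ^+ 2 + b ^+ 2 = 1.
  by rewrite !exprMn -mulrDl addrC -rhoE -exprMn divff// expr1n.
pose G (p : n.-tuple R * n.-tuple R) :=
  (sqdist (lincomb tau 0 p.1 p.1) (f (e (lincomb tau sigma p.1 p.2))))%:E.
have mG : measurable_fun [set: n.-tuple R * n.-tuple R] G.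
  apply/measurable_EFinP; apply: measurable_sqdist; first exact: measurable_lincomb.
  apply: (measurableT_comp (measurable_codebook f me)).
  exact: measurable_lincomb.
have G0 p : (0 <= G p)%E by rewrite lee_fin sqdist_ge0.
have -> : (\int[std_normal_vec n]_t \int[normal_vec sigma (lincomb tau 0 t t)]_x
     (sqdist (lincomb tau 0 t t) (f (e x)))%:E =
     \int[std_normal_vec n]_t \int[std_normal_vec n]_z G (t, z))%E.
  apply: eq_integral => t _.
  apply: etrans (ge0_integral_sqdist_risk _ f (lt0r_neq0 sg0) me) _.
  apply: eq_integral => z _; rewrite /G/=; congr (sqdist _ (f (e _)))%:E.
  by apply: eq_from_tnth => i; rewrite !tnth_mktuple mul0r addr0 mul1r.
rewrite (ge0_integral_std_normal_vec_rotation ab b0 mG G0).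
pose q y := f (e (lincomb rho 0 y y)).
(* The parameter [tau t] becomes [al y + be w], with [al = tau^2 / rho] and
   [be = tau sigma / rho]. *)
pose al := tau * a; pose be := tau * b.
have al0 : 0 < al by rewrite mulr_gt0.
have rotE y w : G (lincomb a b y w, lincomb b (- a) y w) = (sqdist (lincomb al be y w) (q y))%:E.
  rewrite /G/= /q; congr (sqdist _ (f (e _)))%:E;
    apply: eq_from_tnth => i; rewrite !tnth_mktuple /al /be; first by ring.
  have -> : rho = tau * a + sigma * b.
    by rewrite /a /b !mulrA -mulrDl -!expr2 addrC -rhoE expr2 mulfK.
  by rewrite /a /b; ring.
(* Dividing the codewords by [al] turns the code into a quantizer of the standard vector [y]
   itself. *)
pose f' k := lincomb al^-1 0 (f k) (f k).
pose e' y := e (lincomb rho 0 y y).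
have me' := measurable_comp_lincomb rho me.
pose D y := sqdist y (f' (e' y)).
have DE y : \sum_(i < n) (al * tnth y i - tnth (q y) i) ^+ 2 = al ^+ 2 * D y.
  rewrite mulr_sumr; apply: eq_bigr => i _.
  by rewrite /f' /e' tnth_mktuple; field; rewrite gt_eqF.
have mD : measurable_fun [set: n.-tuple R] (fun y => (D y)%:E).
  apply/measurable_EFinP; apply: measurable_sqdist => //.
  exact: (measurable_codebook f' me').
have D0 y : (0 <= (D y)%:E)%E by rewrite lee_fin sqdist_ge0.
have al20 : (0 <= (al ^+ 2)%:E)%E by rewrite lee_fin sqr_ge0.
have be20 : (0 <= (be ^+ 2 * n%:R)%:E)%E by rewrite lee_fin mulr_ge0// sqr_ge0.
have maD : measurable_fun [set: n.-tuple R] (fun y => (al ^+ 2)%:E * (D y)%:E)%E.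
  exact: emeasurable_funM.
(* The integral over [w] is bounded first, at fixed [y]; what remains is the quantization error of
   [y]. *)
apply: (@le_trans _ _ (\int[std_normal_vec n]_y
    ((al ^+ 2)%:E * (D y)%:E + (be ^+ 2 * n%:R)%:E))%E); last first.
  pose G' p := G (lincomb a b p.1 p.2, lincomb b (- a) p.1 p.2).
  have mG' : measurable_fun [set: n.-tuple R * n.-tuple R] G'.
    by apply: (measurableT_comp mG); apply: measurable_fun_pair; exact: measurable_lincomb.
  apply: ge0_le_integral => [//|y _| | |y _].
  - by rewrite adde_ge0// mule_ge0.
  - exact: emeasurable_funD.
  - exact: (measurable_fun_fubini_tonelli_F G' mG' (fun=> G0 _)).
  - apply: le_trans (_ : (_ <= \int[std_normal_vec n]_w (sqdist (lincomb al be y w) (q y))%:E)%E) _.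
      rewrite -EFinM -EFinD -DE; exact: integral_sqdist_lincomb_ge.
    by rewrite le_eqVlt; apply/orP; left; apply/eqP; apply: eq_integral => w _; rewrite rotE.
rewrite (ge0_integralD _ measurableT (fun y _ => mule_ge0 al20 (D0 y)) maD
  (fun _ _ => be20) (measurable_cst _)).
rewrite (ge0_integralZl _ measurableT mD (fun y _ => D0 y) al20).
rewrite integral_cst_probability.
apply: (@le_trans _ _ ((al ^+ 2)%:E * (n%:R * s ^+ 2)%:E + (be ^+ 2 * n%:R)%:E)%E).
  rewrite -EFinM -EFinD lee_fin le_eqVlt; apply/orP; left; apply/eqP.
  rewrite /al /be /a /b -rhoE; field; exact: rhoN0.
apply: leeD2r; apply: lee_wpmul2l => //.
exact: integral_quantization_error_ge.
Qed.

End bayes_risk.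

(** * Minimax risk over the ball *)

Section truncation.
Context {R : realType}.

Definition trim n (T : R) (u : n.-tuple R) : n.-tuple R :=
  if normsq u <= 4 * T then u else nseq_tuple n 0.

Lemma sqdist_nseq0 n (u : n.-tuple R) : sqdist u (nseq_tuple n 0) = normsq u.
Proof. by apply: eq_bigr => i _; rewrite tnth_nseq subr0. Qed.

Lemma sqdist_ge n (u v : n.-tuple R) :
  2^-1 * normsq v - normsq u <= sqdist u v.
Proof.
rewrite mulr_sumr -sumrB; apply: ler_sum => i _.
have := sqr_ge0 (2 * tnth u i - tnth v i); nra.
Qed.

Lemma sqdist_le n (u v : n.-tuple R) : sqdist u v <= 2 * normsq u + 2 * normsq v.
Proof.
rewrite !mulr_sumr -big_split; apply: ler_sum => i _ /=.
have := sqr_ge0 (tnth u i + tnth v i); nra.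
Qed.

(** A codeword with [|v|^2 > 4 T] is at squared distance more than [2 T - |u|^2 >= T] from [u],
    whereas 0 is at squared distance [|u|^2 <= T]. *)
Lemma sqdist_trim_le n (T : R) (u v : n.-tuple R) : normsq u <= T ->
  sqdist u (trim T v) <= sqdist u v.
Proof.
move=> uT; rewrite /trim; case: ifPn => //; rewrite -ltNge => vT.
rewrite sqdist_nseq0; have := sqdist_ge u v.
by move: uT vT; lra.
Qed.

Lemma sqdist_trim_ub n (T : R) (u v : n.-tuple R) : 0 <= T ->
  sqdist u (trim T v) <= 2 * normsq u + 8 * T.
Proof.
move=> T0; apply: le_trans (sqdist_le _ _) _.
suff : normsq (trim T v) <= 4 * T by lra.
rewrite /trim; case: ifPn => // _.
by rewrite /normsq big1 ?mulr_ge0// => i _; rewrite tnth_nseq expr0n.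
Qed.

Lemma normsq_lincomb0 n (a : R) (t : n.-tuple R) :
  normsq (lincomb a 0 t t) = a ^+ 2 * normsq t.
Proof. by rewrite mulr_sumr; apply: eq_bigr => i _; rewrite tnth_mktuple; ring. Qed.

(** The number h of the bound K / (1 + n h): it equals [(1 + (r^2 - 1) / 2) / r - 1]. *)
Definition gap (r : R) := (r - 1) ^+ 2 / (2 * r).

(** The number K. The first term is the weight [2 c^2 + 8 c^2] per coordinate on the boundary of the
    ball; the second covers its growth beyond the boundary. *)
Definition tail_cst (r c : R) := 10 * c ^+ 2 + 4 * c ^+ 2 / (r ^+ 2 - 1).

Lemma gap_gt0 (r : R) : 1 < r -> 0 < gap r.
Proof.
move=> r1; rewrite divr_gt0 ?exprn_gt0 ?subr_gt0// mulr_gt0//.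
exact: lt_trans r1.
Qed.

Lemma tail_cst_ge0 (r c : R) : 1 < r -> 0 <= tail_cst r c.
Proof.
move=> r1; have r21 : 0 <= r ^+ 2 - 1 by nra.
by rewrite addr_ge0 ?divr_ge0// mulr_ge0// sqr_ge0.
Qed.

(* Outside the ball the weight [2 |theta|^2 + 8 n c^2] is dominated by the
   likelihood ratio of the prior N(0, c^2) with respect to N(0, (c / r)^2). *)
Lemma likelihood_tail_ge n (r c : R) (t : n.-tuple R) : (0 < n)%N -> 1 < r -> 0 < c ->
  n%:R * c ^+ 2 < normsq (lincomb (c / r) 0 t t) ->
  2 * normsq (lincomb (c / r) 0 t t) + 8 * (n%:R * c ^+ 2) <=
  n%:R * tail_cst r c / (1 + n%:R * gap r) *
  (expR (\sum_(i < n) (tnth t i ^+ 2 / 2 -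
    (tnth t i - tnth (nseq_tuple n (0 : R)) i) ^+ 2 / (2 * r ^+ 2))) / r ^+ n).
Proof.
move=> n0 r1 c0; rewrite normsq_lincomb0 => tn.
have r0 : 0 < r by exact: lt_trans r1.
have n1 : 1 <= n%:R :> R by rewrite ler1n.
set q := normsq t in tn *.
pose k := (1 - r ^- 2) / 2.
(* The excess of [|t|^2] over its value on the boundary of the ball; [k] is the coefficient of
   [|t|^2] in the log-likelihood ratio. *)
pose x := q - n%:R * r ^+ 2.
have x0 : 0 < x.
  move: tn; rewrite expr_div_n mulrAC ltr_pdivlMr ?exprn_gt0// => tn.
  rewrite subr_gt0 -(ltr_pM2l (exprn_gt0 2 c0)).
  by rewrite mulrCA mulrA.
have r21 : 0 < r ^+ 2 - 1 by nra.
have k0 : 0 < k.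
  by rewrite divr_gt0// subr_gt0 invf_lt1 ?exprn_gt0// -subr_gt0.
have -> : \sum_(i < n) (tnth t i ^+ 2 / 2 -
    (tnth t i - tnth (nseq_tuple n (0 : R)) i) ^+ 2 / (2 * r ^+ 2)) =
    k * x + n%:R * ((r ^+ 2 - 1) / 2).
  transitivity (k * q).
    rewrite mulr_sumr; apply: eq_bigr => i _; rewrite tnth_nseq subr0 /k.
    by field; rewrite gt_eqF.
  by rewrite /x /k; field; rewrite gt_eqF.
have g0 : 0 <= gap r := ltW (gap_gt0 r1).
rewrite expRD.
(* On the boundary the likelihood ratio is [(exp ((r^2 - 1) / 2) / r)^n >= (1 + gap r)^n], which
   grows at least linearly in [n]. *)
have E : 1 + n%:R * gap r <= expR (n%:R * ((r ^+ 2 - 1) / 2)) / r ^+ n.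
  apply: le_trans (bernoulli_ge n g0) _.
  rewrite expRM_natl -expr_div_n lerXn2r ?nnegrE ?addr_ge0//.
    by rewrite divr_ge0 ?expR_ge0// ltW.
  rewrite ler_pdivlMr//; apply: le_trans (expR_ge1Dx _).
  by rewrite le_eqVlt; apply/orP; left; apply/eqP; rewrite /gap; field; rewrite gt_eqF.
have d0 : 0 < 1 + n%:R * gap r by rewrite ltr_pwDl// mulr_ge0.
have K0 := tail_cst_ge0 c r1.
(* By [exp (k x) >= 1 + k x] it remains to compare two affine functions of [x]. *)
apply: (@le_trans _ _ (n%:R * tail_cst r c * (1 + k * x))); last first.
  move: E; set e := expR (n%:R * _); set p := r ^+ n => E.
  have -> : n%:R * tail_cst r c / (1 + n%:R * gap r) * (expR (k * x) * e / p) =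
    n%:R * tail_cst r c * (expR (k * x) * (e / p / (1 + n%:R * gap r))) by ring.
  rewrite ler_wpM2l// ?mulr_ge0// -[leLHS]mulr1.
  apply: ler_pM => //; first by rewrite addr_ge0// (mulr_ge0 (ltW k0) (ltW x0)).
    exact: expR_ge1Dx.
  by rewrite ler_pdivlMr// mul1r.
have kc : k * (4 * c ^+ 2 / (r ^+ 2 - 1)) = 2 * (c / r) ^+ 2.
  by rewrite /k; field; rewrite !gt_eqF.
have qE : (c / r) ^+ 2 * q = (c / r) ^+ 2 * x + n%:R * c ^+ 2.
  by rewrite /x; field; rewrite gt_eqF.
have : 0 <= k * x * (10 * c ^+ 2).
  by apply: mulr_ge0 (mulr_ge0 (ltW k0) (ltW x0)) _; rewrite mulr_ge0// sqr_ge0.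
have : 0 <= 4 * c ^+ 2 / (r ^+ 2 - 1) by rewrite divr_ge0 ?mulr_ge0 ?sqr_ge0// ltW.
have : 0 <= (c / r) ^+ 2 * x by exact: mulr_ge0 (sqr_ge0 _) (ltW x0).
rewrite qE /tail_cst.
have -> : n%:R * (10 * c ^+ 2 + 4 * c ^+ 2 / (r ^+ 2 - 1)) * (1 + k * x) =
  n%:R * (10 * c ^+ 2 + 4 * c ^+ 2 / (r ^+ 2 - 1) + k * x * (10 * c ^+ 2) +
    k * (4 * c ^+ 2 / (r ^+ 2 - 1)) * x) by ring.
rewrite kc.
move: (4 * c ^+ 2 / (r ^+ 2 - 1)) (k * x * (10 * c ^+ 2)) ((c / r) ^+ 2) => u v w.
move=> wx u0 v0.
have : 0 <= n%:R * u by rewrite mulr_ge0.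
have : 0 <= n%:R * v by rewrite mulr_ge0.
have : w * x <= n%:R * (w * x) by rewrite ler_peMl.
by lra.
Qed.

End truncation.

(** * From the Bayes risk to the minimax risk *)

Section minimax.
Context {R : realType}.

(** Makes [s = 2^(- B)] admissible in the quantization bound. *)
Lemma codebook_size_le n (B : R) : 0 <= B ->
  (codebook_size n B)%:R * (2 `^ (- B)) ^+ n <= 1.
Proof.
move=> B0.
have -> : (2 `^ (- B)) ^+ n = 2 `^ (- (n%:R * B)).
  by rewrite -powR_mulrn ?powR_ge0// -powRrM mulNr mulrC.
rewrite powRN ler_pdivrMr ?powR_gt0// mul1r.
by rewrite truncn_le powR_ge0.
Qed.

Lemma measurable_sqdist_quantize n (B : R) (M : rate_code n B)
    (theta : n.-tuple R) :
  measurable_fun [set: n.-tuple R] (fun x => (sqdist theta (quantize M x))%:E).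
Proof.
apply/measurable_EFinP; apply: measurable_sqdist => //.
exact: (measurable_codebook (decoder M) (@measurable_encoder _ _ _ M)).
Qed.

Lemma integral_sqdist_quantize n (B sigma : R) (M : rate_code n B)
    (theta : n.-tuple R) : (0 < n)%N ->
  (\int[normal_vec sigma theta]_x (sqdist theta (quantize M x))%:E =
   n%:R%:E * risk sigma M theta)%E.
Proof.
move=> n0; rewrite /risk unlock.
have n1 : (0 <= (n%:R^-1 : R)%:E)%E by rewrite lee_fin invr_ge0.
have s0 x : (0 <= (sqdist theta (quantize M x))%:E)%E by rewrite lee_fin sqdist_ge0.
rewrite -[X in _ = (_ * X)%E]/(\int[normal_vec sigma theta]_x
  ((n%:R^-1)%:E * (sqdist theta (quantize M x))%:E))%E.
rewrite (ge0_integralZl _ measurableT (measurable_sqdist_quantize M theta)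
  (fun x _ => s0 x) n1).
by rewrite muleA -EFinM divff ?mul1e// pnatr_eq0 -lt0n.
Qed.

(** The bound of [bayes_risk_ge] per coordinate at [s = 2^(- B)]; at [tau = c] it is the bound of
    the theorem. *)
Definition risk_bound (B sigma tau : R) :=
  tau ^+ 2 * sigma ^+ 2 / (sigma ^+ 2 + tau ^+ 2) +
  tau ^+ 4 / (sigma ^+ 2 + tau ^+ 2) * (2 `^ (- B)) ^+ 2.

Lemma risk_bound_ge0 (B sigma tau : R) : 0 <= risk_bound B sigma tau.
Proof.
have h : 0 <= sigma ^+ 2 + tau ^+ 2 by rewrite addr_ge0// sqr_ge0.
apply: addr_ge0; first exact: divr_ge0 (mulr_ge0 (sqr_ge0 _) (sqr_ge0 _)) h.
by apply: mulr_ge0 (sqr_ge0 _); apply: divr_ge0 h; exact: exprn_even_ge0.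
Qed.

Lemma sup_risk_ge n (B sigma c r : R) (M : rate_code n B) :
  (0 < n)%N -> 0 <= B -> 0 < sigma -> 0 < c -> 1 < r ->
  ((risk_bound B sigma (c / r) - tail_cst r c / (1 + n%:R * gap r))%:E <=
   ereal_sup [set risk sigma M theta | theta in Theta c])%E.
Proof.
move=> n0 B0 sg0 c0 r1.
set S := ereal_sup _.
have r0 : 0 < r by exact: lt_trans r1.
have n0R : 0 < n%:R :> R by rewrite ltr0n.
pose tau := c / r.
have tau0 : 0 < tau by rewrite divr_gt0.
pose T := n%:R * c ^+ 2.
have T0 : 0 <= T by rewrite mulr_ge0// sqr_ge0.
pose f k := trim T (decoder M k).
have me := @measurable_encoder _ _ _ M.
pose g (theta : n.-tuple R) :=
  (\int[normal_vec sigma theta]_x (sqdist theta (f (encoder M x)))%:E)%E.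
have mg theta : measurable_fun [set: n.-tuple R]
    (fun x => (sqdist theta (f (encoder M x)))%:E).
  apply/measurable_EFinP; apply: measurable_sqdist => //.
  exact: (measurable_codebook f me).
have ThetaE (theta : n.-tuple R) : Theta c theta <-> normsq theta <= T.
  by rewrite /Theta /mkset -/(normsq theta) ler_pdivrMl.
have g_in theta : normsq theta <= T -> (g theta <= n%:R%:E * S)%E.
  move=> thT; apply: (@le_trans _ _ (n%:R%:E * risk sigma M theta)%E); last first.
    apply: lee_wpmul2l; first by rewrite lee_fin ltW.
    by apply: ereal_sup_ubound; exists theta => //; exact/ThetaE.
  rewrite -integral_sqdist_quantize//; apply: ge0_le_integral => [//|x _| | |x _].
  - by rewrite lee_fin sqdist_ge0.
  - exact: mg.
  - exact: (measurable_sqdist_quantize M theta).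
  - by rewrite lee_fin; exact: sqdist_trim_le.
have g_out theta : (g theta <= (2 * normsq theta + 8 * T)%:E)%E.
  rewrite -[leRHS](integral_cst_probability (normal_vec sigma theta)).
  apply: ge0_le_integral => [//|x _| | |x _].
  - by rewrite lee_fin sqdist_ge0.
  - exact: mg.
  - exact: measurable_cst.
  - by rewrite lee_fin; exact: sqdist_trim_ub.
have S0 : (0 <= S)%E.
  apply: (@le_trans _ _ (risk sigma M (nseq_tuple n 0))).
    rewrite /risk unlock; apply: integral_ge0 => x _.
    by rewrite lee_fin mulr_ge0 ?invr_ge0// sqdist_ge0.
  apply: ereal_sup_ubound; exists (nseq_tuple n 0) => //; apply/ThetaE.
  by rewrite /normsq big1// => i _; rewrite tnth_nseq expr0n.
pose L (t : n.-tuple R) := expR (\sum_(i < n) (tnth t i ^+ 2 / 2 -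
    (tnth t i - tnth (nseq_tuple n (0 : R)) i) ^+ 2 / (2 * r ^+ 2))) / r ^+ n.
have L0 t : (0 <= (L t)%:E)%E by rewrite lee_fin divr_ge0 ?expR_ge0// exprn_ge0// ltW.
have mL : measurable_fun [set: n.-tuple R] (fun t => (L t)%:E).
  apply/measurable_EFinP; apply: measurable_funM => //.
  apply: measurableT_comp => //; apply: measurable_sum => i.
  by apply: measurable_funB; apply: measurable_funM => //; apply: measurable_funX;
    try apply: measurable_funB => //; exact: measurable_tnth.
have iL : (\int[std_normal_vec n]_t (L t)%:E = 1)%E.
  exact: integral_std_normal_vec_likelihood.
pose K := n%:R * tail_cst r c / (1 + n%:R * gap r).
have K0 : (0 <= K%:E)%E.
  have k0 := tail_cst_ge0 c r1; have g0 := ltW (gap_gt0 r1).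
  rewrite lee_fin; apply: divr_ge0 (mulr_ge0 (ltW n0R) k0) _.
  exact: addr_ge0 ler01 (mulr_ge0 (ltW n0R) g0).
have nS0 : (0 <= n%:R%:E * S)%E by rewrite mule_ge0// lee_fin ltW.
(* In the ball the first term bounds the risk of the trimmed code, outside it the second does. Both
   terms are nonnegative, so their sum bounds it everywhere and the prior integral need not be
   split. *)
have pw t : (g (lincomb tau 0 t t) <= n%:R%:E * S + K%:E * (L t)%:E)%E.
  have [tT|tT] := leP (normsq (lincomb tau 0 t t)) T.
    by rewrite -[leLHS]adde0; apply: leeD; [exact: g_in|exact: mule_ge0].
  apply: le_trans (g_out _) _.
  rewrite -[leLHS]add0e; apply: leeD => //.
  by rewrite -EFinM lee_fin; exact: likelihood_tail_ge.
have mgt : measurable_fun [set: n.-tuple R] (fun t => g (lincomb tau 0 t t)).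
  pose G (p : n.-tuple R * n.-tuple R) := (sqdist (lincomb tau 0 p.1 p.1)
    (f (encoder M (lincomb 1 sigma (lincomb tau 0 p.1 p.1) p.2))))%:E.
  have mG : measurable_fun [set: n.-tuple R * n.-tuple R] G.
    apply/measurable_EFinP; apply: measurable_sqdist; first exact: measurable_lincomb.
    apply: (measurableT_comp (measurable_codebook f me)).
    by apply: measurable_lincomb => //; exact: measurable_lincomb.
  have G0 p : (0 <= G p)%E by rewrite lee_fin sqdist_ge0.
  have := measurable_fun_fubini_tonelli_F (m2 := std_normal_vec n) G mG G0.
  apply: eq_measurable_fun => t _.
  by rewrite /g (ge0_integral_sqdist_risk _ f (lt0r_neq0 sg0) me).
have bayes : ((n%:R * risk_bound B sigma tau)%:E <= n%:R%:E * S + K%:E)%E.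
  apply: le_trans (bayes_risk_ge f sg0 tau0 (powR_gt0 _ _) (codebook_size_le n B0) me) _ => //.
  apply: (@le_trans _ _ (\int[std_normal_vec n]_t (n%:R%:E * S + K%:E * (L t)%:E))%E).
    apply: ge0_le_integral => [//|t _| | |t _].
    - by apply: integral_ge0 => x _; rewrite lee_fin sqdist_ge0.
    - exact: mgt.
    - by apply: emeasurable_funD; [exact: measurable_cst|exact: emeasurable_funM].
    - exact: pw.
  have mKL : measurable_fun [set: n.-tuple R] (fun t => K%:E * (L t)%:E)%E.
    exact: emeasurable_funM.
  rewrite (ge0_integralD _ measurableT (fun _ _ => nS0) (measurable_cst _)
    (fun t _ => mule_ge0 K0 (L0 t)) mKL).
  rewrite integral_cst_probability (ge0_integralZl _ measurableT mL (fun t _ => L0 t) K0).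
  by rewrite iL mule1.
have [->|Sy] := eqVneq S +oo%E; first exact: leey.
have Sf : S \is a fin_num by rewrite ge0_fin_numE// ltey.
move: bayes; rewrite -(fineK Sf) -EFinM -EFinD !lee_fin /K => H.
rewrite lerBlDr -(ler_pM2l n0R); apply: le_trans H _.
by rewrite le_eqVlt; apply/orP; left; apply/eqP; ring.
Qed.

(** Shrinking the prior from [c] to [c / r] costs at most a factor [r^4], which tends to 1 with
    [r]. *)
Lemma risk_bound_ge (B sigma c r : R) : 0 < sigma -> 0 < c -> 1 < r ->
  sigma ^+ 2 * c ^+ 2 / (sigma ^+ 2 + c ^+ 2) +
  c ^+ 4 / (sigma ^+ 2 + c ^+ 2) * 2 `^ (- (2 * B)) <=
  risk_bound B sigma (c / r) * r ^+ 4.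
Proof.
move=> s0 c0 r1; have r0 : 0 < r by exact: lt_trans r1.
have -> : 2 `^ (- (2 * B)) = (2 `^ (- B)) ^+ 2.
  by rewrite -powR_mulrn ?powR_ge0// -powRrM mulNr mulrC.
rewrite /risk_bound; set b := (2 `^ (- B)) ^+ 2.
have b0 : 0 <= b by exact: sqr_ge0.
have s20 : 0 < sigma ^+ 2 by rewrite exprn_gt0.
have c20 : 0 < c ^+ 2 by rewrite exprn_gt0.
have r21 : 1 <= r ^+ 2 by rewrite exprn_ege1// ltW.
have d0 : 0 < sigma ^+ 2 * r ^+ 2 + c ^+ 2 by rewrite addr_gt0// mulr_gt0// exprn_gt0.
have -> : ((c / r) ^+ 2 * sigma ^+ 2 / (sigma ^+ 2 + (c / r) ^+ 2) +
    (c / r) ^+ 4 / (sigma ^+ 2 + (c / r) ^+ 2) * b) * r ^+ 4 =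
  (sigma ^+ 2 * c ^+ 2 * r ^+ 2 * r ^+ 2 + c ^+ 2 * c ^+ 2 * r ^+ 2 * b) /
  (sigma ^+ 2 * r ^+ 2 + c ^+ 2).
  by field; rewrite !gt_eqF// exprMn.
have -> : sigma ^+ 2 * c ^+ 2 / (sigma ^+ 2 + c ^+ 2) +
    c ^+ 4 / (sigma ^+ 2 + c ^+ 2) * b =
  (sigma ^+ 2 * c ^+ 2 + c ^+ 2 * c ^+ 2 * b) / (sigma ^+ 2 + c ^+ 2).
  by field; rewrite gt_eqF// addr_gt0.
rewrite ler_pdivlMr// [leLHS]mulrAC ler_pdivrMr ?addr_gt0//.
move: (sigma ^+ 2) (c ^+ 2) (r ^+ 2) s20 c20 r21 => s d q s20 d20 q1.
(* The difference of the cross-multiplied sides, with the factor [q - 1 >= 0] made visible in each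
   term. *)
rewrite -subr_ge0; apply: le_trans (_ : 0 <= s * d * (s * q * (q - 1) +
  d * (q - 1) * (q + 1)) + d * d * b * d * (q - 1)) _; last first.
  by rewrite le_eqVlt; apply/orP; left; apply/eqP; ring.
have p1 : 0 <= q - 1 by rewrite subr_ge0.
have p2 : 0 <= q + 1 by lra.
have p3 : 0 <= s * q by rewrite mulr_ge0 ?(ltW s20)//; lra.
have [p4 p5] := (ltW s20, ltW d20).
apply: addr_ge0; last by rewrite !mulr_ge0.
exact: mulr_ge0 (mulr_ge0 p4 p5) (addr_ge0 (mulr_ge0 p3 p1)
  (mulr_ge0 (mulr_ge0 p5 p1) p2)).
Qed.

End minimax.

(** * Passage to the limit *)

Lemma limn_einf_ge {R : realType} (u : (\bar R)^nat) (l : \bar R) (N : nat) :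
  (forall n, (N <= n)%N -> (l <= u n)%E) -> (l <= limn_einf u)%E.
Proof.
move=> H; rewrite limn_einf_lim; apply: lime_ge; first exact: is_cvg_einfs.
exists N => // n /= Nn; apply: le_ereal_inf_tmp => _ [m /= nm <-].
exact/H/(leq_trans Nn).
Qed.

Theorem theorem3p1 (R : realType) (B sigma c : R) (hB : 0 <= B)
    (hsigma : 0 < sigma) (hc : 0 < c) :
  ((sigma ^+ 2 * c ^+ 2 / (sigma ^+ 2 + c ^+ 2)
    + c ^+ 4 / (sigma ^+ 2 + c ^+ 2) * 2 `^ (- (2 * B)))%:E
   <= asymptotic_minimax_risk B sigma c)%E.
Proof.
rewrite /asymptotic_minimax_risk; set X := limn_einf _; set L0 := _ + _ * _.
have lower r e : 1 < r -> 0 < e -> ((risk_bound B sigma (c / r) - e)%:E <= X)%E.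
  (* For [n > N] one has [tail_cst r c <= n e gap r], so the tail term is at most [e]; starting at
     [N.+1] also gives [0 < n]. *)
  move=> r1 e0; pose N := Num.truncn (tail_cst r c / (e * gap r)).
  apply: (@limn_einf_ge _ _ _ N.+1) => n Nn.
  have n0 : (0 < n)%N by exact: leq_trans Nn.
  apply: le_ereal_inf_tmp => _ [M _ <-].
  apply: le_trans (sup_risk_ge M n0 hB hsigma hc r1).
  have g0 := gap_gt0 r1; have eg0 : 0 < e * gap r by rewrite mulr_gt0.
  rewrite lee_fin lerD2l lerN2 ler_pdivrMr; last first.
    by rewrite ltr_pwDl// mulr_ge0// ltW.
  have : tail_cst r c / (e * gap r) <= n%:R.
    apply: le_trans (ltW (truncnS_gt _)) _.
    by rewrite ler_nat.
  by rewrite ler_pdivrMr//; move: e0; lra.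
have L0r r : 1 < r -> L0 <= risk_bound B sigma (c / r) * r ^+ 4.
  exact: risk_bound_ge.
(* The value [-oo] is excluded by any instance of [lower]; the last line takes [r = 2] and
   [e = 1]. *)
case: X lower => [x| |] lower; [|exact: leey|].
  rewrite lee_fin.
  have lower' r : 1 < r -> risk_bound B sigma (c / r) <= x.
    move=> r1; apply/ler_addgt0Pr => e e0.
    by have := lower r e r1 e0; rewrite lee_fin lerBlDr.
  have x0 : 0 <= x.
    apply: le_trans (lower' 2 _); last by rewrite ltr1n.
    exact: risk_bound_ge0.
  (* With [r = 1 + t], the constant is [4 + 6 + 4 + 1]: [(1 + t)^4 <= 1 + 15 t] for [0 < t <= 1]. *)
  apply: (@le_of_le_mul1D _ _ _ 15) => // t t0 t1.
  have r1 : 1 < 1 + t by rewrite ltrDl.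
  apply: le_trans (L0r _ r1) _.
  apply: le_trans (ler_wpM2r _ (lower' _ r1)) _.
    by rewrite exprn_ge0// addr_ge0// ltW.
  rewrite ler_wpM2l//.
  have t2 : t * t <= t by rewrite ler_piMr// ltW.
  have t3 : t * (t * t) <= t by rewrite (le_trans _ t2)// ler_wpM2l// ltW.
  have t4 : t * (t * (t * t)) <= t by rewrite (le_trans _ t2)// ler_wpM2l// ltW.
  by lra.
by have := lower 2 1 _ ltr01; rewrite leeNy_eq ltr1n => /(_ isT).
Qed.
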